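(* Let $W_\infty$ be an oriented doubly periodic weave in $\mathbb{E}^2\times I$, and let $D_{W_1}$ and $D_{W_2}$ be two connected minimal reduced alternating diagrams (weaving motifs on the torus $T^2$) of $W_\infty$. Then $D_{W_1}$ and $D_{W_2}$ have the same writhe: $w_r(D_{W_1})=w_r(D_{W_2})$.
   Context: Let $I=[-1,1]$ and let $T^2=\mathbb{E}^2/\Lambda$, with $\Lambda=\Lambda(u,v)=\{xu+yv:x,y\in\mathbb{Z}\}$ for a basis $u,v$ of $\mathbb{E}^2$. An essential closed curve component of a link in $T^2\times I$ lifts to infinite open curves in $\mathbb{E}^2\times I$ called threads; a thread is unknotted if its projection to $\mathbb{E}^2$ has no self-crossing. Two components are parallel if they are homotopic to the same $(p,q)$-torus knot. Doubly periodic weave. Let $W\subset T^2\times I$ be a link such that each component $t_i$ is homotopic to a $(p_i,q_i)$-torus knot with $p_i,q_i$ coprime, each component lifts to an unknotted thread, and $W$ contains at least two non-parallel components. The lift $W_\infty$ of $W$ to $\mathbb{E}^2\times I$ is a doubly periodic weave, and the diagram $D_W$ of $W$ on $T^2$ is a weaving motif. For a fixed lattice, motifs represent the same weave when they are related by finitely many Reidemeister moves $R_1,R_2,R_3$, torus isotopies and Dehn twists. $W_\infty$ is oriented when the components are oriented, and motifs carry the induced orientation. Minimal. For lattices of the same weave, write $\Lambda\subseteq\Lambda'$ when a unit cell of $\Lambda'$ is tiled by unit cells of $\Lambda$ (e.g. $u'=k_uu$, $v'=k_vv$ with $k_u,k_v$ positive integers). A minimal lattice $\Lambda_{\min}$ is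 a periodic lattice of $W_\infty$ with $\Lambda_{\min}\subseteq\Lambda$ for every periodic lattice $\Lambda$ of $W_\infty$. A motif is minimal if it is a motif for $\Lambda_{\min}$. A motif is alternating if its crossings alternate between over and under along each component. A motif is reduced if its lift to $\mathbb{E}^2$ has no nugatory crossing, where a crossing is nugatory if two of the four local regions at it are part of the same region of the infinite diagram. The writhe $w_r(D)$ of an oriented diagram is the sum of the signs $\pm1$ of all its crossings (usual sign convention). *)

(* Defs.v *)
From HB Require Import structures.
From Stdlib Require Export Relation_Operators.
From mathcomp Require Export all_boot all_order all_algebra all_fingroup.
From mathcomp Require Export boolp classical_sets reals.

Set Implicit Arguments.
Unset Strict Implicit.
Unset Printing Implicit Defensive.

Import Order.TTheory GRing.Theory Num.Theory.
Local Open Scope ring_scope.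

Section Plane.
Variable R : realType.

Definition plane := 'rV[R]_2.

Definition det2 (a b : plane) : R := \det (col_mx a b : 'M_2).

Definition lattice_span (u v : plane) : set plane :=
  fun w => exists x y : int, w = u *~ x + v *~ y.

Definition lattice_basis (L : set plane) (u v : plane) : Prop :=
  det2 u v != 0 /\ L = lattice_span u v.

(* [tiled_by L L'] is the order written L ⊆ L' for lattices of one weave: some
   unit cell of L' is a ku x kv block of unit cells of L.  By the stacked basis
   theorem this holds exactly when L' is a subgroup of L, so the least lattice
   for this order is the largest one as a set of translations. *)
Definition tiled_by (L L' : set plane) : Prop :=
  exists u v u' v' : plane, exists ku kv : nat,
    [/\ lattice_basis L u v, lattice_basis L' u' v', (0 < ku)%N, (0 < kv)%N
      & u' = u *+ ku /\ v' = v *+ kv].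

(* An oriented link diagram on the torus plane/L, where L is spanned by
   cell_u, cell_v, encoded by its signed Gauss code drawn in the plane.
   - A passage (x, b) is the strand going through the crossing x above (b = true)
     or below (b = false); sgn x = true for a positive crossing.
   - nxt p is the passage that follows p along the oriented component.
   - pos x is a representative in the plane of the point x of plane/L.
   - dsp p is the displacement, along a lift to the plane of the arc from p to
     nxt p, from the first crossing point to the second.
   The arcs themselves are remembered up to isotopy: the signs and the code
   determine the cyclic order of the arcs around each crossing, hence the
   regions (see [face]), and dsp determines the homotopy classes of the arcs.
   This encodes all diagrams whose regions are discs.  Diagrams of links with two
   non-parallel essential components and no inessential component are such: each
   component meets another one (any two non-parallel classes have non-zero
   intersection number), so the diagram is connected and its regions are
   discs. *)
Record diagram := Diagram {
  cell_u : plane;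
  cell_v : plane;
  crossing : finType;
  sgn : crossing -> bool;
  nxt : {perm crossing * bool};
  pos : crossing -> plane;
  dsp : crossing * bool -> plane }.

Definition passage (D : diagram) : finType := (crossing D * bool)%type.

Definition lattice (D : diagram) : set plane :=
  lattice_span (cell_u D) (cell_v D).

(* A dart (p, o) is the end at the crossing p.1 of the arc that leaves it
   (o = true) or enters it (o = false) along the passage p. *)
Definition dart (D : diagram) : finType := (passage D * bool)%type.

Section Regions.
Variable D : diagram.

Definition other_end (d : dart D) : dart D :=
  if d.2 then (nxt D d.1, false) else ((nxt D)^-1%g d.1, true).

Definition dart_dsp (d : dart D) : plane :=
  if d.2 then dsp d.1 else - dsp ((nxt D)^-1%g d.1).

(* The next dart counterclockwise around the crossing.  At a positive crossing
   the counterclockwise order is: over out, under out, over in, under in; at a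
   negative one the two under darts are exchanged. *)
Definition rot (d : dart D) : dart D :=
  let: ((x, b), o) := d in ((x, ~~ b), o (+) b (+) sgn x).

(* Clockwise; rot swaps over and under, so its cube is its inverse. *)
Definition rot_inv (d : dart D) : dart D := rot (rot (rot d)).

(* The local regions at a crossing are indexed by its darts, d standing for the
   corner on the left of d.  [face] follows the boundary of the region on the
   left of d, counterclockwise around that region. *)
Definition face (d : dart D) : dart D := rot_inv (other_end d).

(* Signed area of the polygon in the plane whose sides are the displacements
   along the boundary of the region on the left of d. *)
Definition face_area (d : dart D) : R :=
  (\sum_(j < fingraph.order face d) \sum_(i < j)
      det2 (dart_dsp (iter i face d)) (dart_dsp (iter j face d))) / 2%:R.

Definition adjacent (x y : crossing D) : bool :=
  [exists b, ((nxt D (x, b)).1 == y) || ((nxt D (y, b)).1 == x)].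

Definition connected_diagram : Prop := forall x y, connect adjacent x y.

(* The code is realised by a diagram on plane/L with crossing points pos: gluing
   a disc along each region boundary gives a closed surface of Euler
   characteristic 0; region boundaries lift to closed polygons, so the crossing
   points and displacements define a map from that surface to plane/L; and this
   map has degree 1, as the regions together have the area of one unit cell. *)
Definition torus_diagram : Prop :=
  [/\ det2 (cell_u D) (cell_v D) != 0,
      forall x y : crossing D, lattice D (pos x - pos y) -> x = y &
      forall p : passage D, lattice D (pos (nxt D p).1 - pos p.1 - dsp p)] /\
  [/\ connected_diagram,
      (#|crossing D| + fcard face predT = #|passage D|)%N,
      forall d, \sum_(i < fingraph.order face d) dart_dsp (iter i face d) = 0 &
      \sum_(d in froots face) face_area d = `|det2 (cell_u D) (cell_v D)|].

(* Lifts to the plane: P is the lift of the crossing of the passage or dart. *)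
Definition lift_point (x : crossing D) (P : plane) : Prop :=
  lattice D (P - pos x).

Definition lift_nxt (p : passage D * plane) : passage D * plane :=
  (nxt D p.1, p.2 + dsp p.1).

Definition lift_face (d : dart D * plane) : dart D * plane :=
  (face d.1, d.2 + dart_dsp d.1).

(* A lifted crossing two of whose four corners lie in one region of the lift. *)
Definition nugatory (x : crossing D) (P : plane) : Prop :=
  exists d d' : dart D,
    [/\ d.1.1 = x, d'.1.1 = x, d <> d'
      & exists n, iter n lift_face (d, P) = (d', P)].

Definition reduced : Prop := forall x P, lift_point x P -> ~ nugatory x P.

Definition alternating : Prop := forall p : passage D, (nxt D p).2 = ~~ p.2.

Definition writhe : int := \sum_(x : crossing D) (if sgn x then 1 else -1).

(* Components are the orbits of nxt, and free homotopy classes of loops in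
   plane/L x I are elements of L. *)
Definition component_class (p : passage D) : plane :=
  \sum_(q in porbit (nxt D) p) dsp q.

(* Torus knots are taken without orientation: (a, b) and (- a, - b) agree. *)
Definition homotopic_torus_knot (p : passage D) (a b : int) : Prop :=
  let c := cell_u D *~ a + cell_v D *~ b in
  component_class p = c \/ component_class p = - c.

Definition parallel (p q : passage D) : Prop :=
  exists a b : int, homotopic_torus_knot p a b /\ homotopic_torus_knot q a b.

(* The thread through a lifted passage never comes back to the same crossing
   of the lift along the other passage. *)
Definition unknotted_thread (p : passage D) : Prop :=
  forall P n m x b, lift_point p.1 P ->
    let q := iter n lift_nxt (p, P) in
    q.1 = (x, b) -> iter m lift_nxt q <> ((x, ~~ b), q.2).

Definition weaving_motif : Prop :=
  [/\ torus_diagram,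
      forall p : passage D, exists a b : int,
        coprimez a b /\ homotopic_torus_knot p a b,
      forall p : passage D, unknotted_thread p
    & exists p q : passage D, ~ parallel p q].

End Regions.

Definition on_passages (A B : Type) (f : A -> B) (p : A * bool) : B * bool :=
  (f p.1, p.2).

(* Torus isotopy: t x is the displacement of the crossing x. *)
Definition isotopic (D E : diagram) : Prop :=
  lattice D = lattice E /\
  exists (f : crossing D -> crossing E) (t : crossing D -> plane),
    [/\ bijective f,
        forall x, sgn (f x) = sgn x,
        forall p : passage D,
          nxt E (on_passages f p) = on_passages f (nxt D p),
        forall p : passage D,
          dsp (on_passages f p) = dsp p + t (nxt D p).1 - t p.1
      & forall x, lattice D (pos (f x) - pos x - t x)].

(* Up to isotopy, the Dehn twist along a curve in the class u is induced by the
   linear map fixing u and sending v to u + v, for a basis (u, v) of the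
   lattice; this map preserves the lattice. *)
Definition dehn_twist (D E : diagram) : Prop :=
  lattice D = lattice E /\
  exists (u v : plane) (M : 'M[R]_2) (f : crossing D -> crossing E),
    [/\ lattice_basis (lattice D) u v, u *m M = u & v *m M = u + v] /\
    [/\ bijective f,
        forall x, sgn (f x) = sgn x,
        forall p : passage D,
          nxt E (on_passages f p) = on_passages f (nxt D p),
        forall p : passage D, dsp (on_passages f p) = dsp p *m M
      & forall x, pos (f x) = pos x *m M].

(* D is obtained from E by forgetting the crossings in S, both strands going
   straight through them, and no component losing all its crossings.  This is
   what happens to the code when a monogon or a bigon is removed. *)
Definition forgets (D E : diagram) (S : {set crossing E}) : Prop :=
  [/\ lattice D = lattice E,
      forall p : passage E, exists n, (iter n (nxt E) p).1 \notin S
    & exists f : crossing D -> crossing E,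
      [/\ injective f,
          forall y, y \notin S <-> exists x, f x = y,
          forall x, sgn x = sgn (f x),
          forall x, pos x = pos (f x)
        & forall p : passage D, exists n,
          let walk k := iter k (nxt E) (on_passages f p) in
          [/\ forall k, (0 < k <= n)%N -> (walk k).1 \in S,
              walk n.+1 = on_passages f (nxt D p)
            & dsp p = \sum_(k < n.+1) dsp (walk k)]]].

(* Removal of a kink: d bounds a region with one corner. *)
Definition reidemeister1 (D E : diagram) : Prop :=
  exists d : dart E, face d = d /\ forgets D [set d.1.1].

(* Removal of a region with two sides, one of which is over at both of its
   ends or under at both. *)
Definition reidemeister2 (D E : diagram) : Prop :=
  exists d : dart E,
    [/\ face (face d) = d, d.1.1 <> (face d).1.1,
        (other_end d).1.2 = d.1.2
      & forgets D [set d.1.1; (face d).1.1]].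

Section Triangle.
Variable D : diagram.

(* The passage from which the arc of the dart d starts. *)
Definition arc_start (d : dart D) : passage D :=
  if d.2 then d.1 else (nxt D)^-1%g d.1.

(* For a triangular region with boundary d, face d, face (face d): exchange, on
   each of the three strands, the two passages at the ends of a side. *)
Definition slide (d : dart D) : {perm passage D} :=
  (tperm (arc_start d) (nxt D (arc_start d)) *
   tperm (arc_start (face d)) (nxt D (arc_start (face d))) *
   tperm (arc_start (face (face d))) (nxt D (arc_start (face (face d)))))%g.

(* Displacement, inside the triangle, from the crossing of p to that of
   slide d p. *)
Definition slide_dsp (d : dart D) (p : passage D) : plane :=
  \sum_(a <- [:: arc_start d; arc_start (face d); arc_start (face (face d))])
     ((if p == a then dsp a else 0) - (if p == nxt D a then dsp a else 0)).

End Triangle.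

(* A triangle with three distinct corners and a side which is over at both of
   its ends.  The move keeps the crossings and their signs and reverses, on
   each of the three strands, the order of the two crossings. *)
Definition reidemeister3 (D E : diagram) : Prop :=
  lattice D = lattice E /\
  exists (d : dart D) (f : crossing D -> crossing E),
    [/\ face (face (face d)) = d,
        uniq [:: d.1.1; (face d).1.1; (face (face d)).1.1],
        d.1.2 = true & (other_end d).1.2 = true] /\
    [/\ bijective f,
        forall x, sgn (f x) = sgn x,
        forall x, pos (f x) = pos x,
        forall p : passage D, nxt E (on_passages f (slide d p))
                              = on_passages f (slide d (nxt D p))
      & forall p : passage D, dsp (on_passages f (slide d p))
                              = dsp p - slide_dsp d p + slide_dsp d (nxt D p)].

Definition elementary_move (D E : diagram) : Prop :=
  [/\ torus_diagram D, torus_diagram E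
    & [\/ isotopic D E \/ dehn_twist D E, reidemeister1 D E,
          reidemeister2 D E | reidemeister3 D E]].

(* For diagrams on the torus of a fixed lattice. *)
Definition same_weave : diagram -> diagram -> Prop :=
  clos_refl_sym_trans diagram elementary_move.

(* A weave is recorded by its projection to the plane: crossing points with
   their signs, and the succession of passages along the oriented threads. *)
Record plane_diagram := PlaneDiagram {
  plane_crossing : plane -> bool -> Prop;
  plane_nxt : plane * bool -> plane * bool -> Prop }.

Definition lift (D : diagram) : plane_diagram := {|
  plane_crossing := fun P s =>
    exists2 x : crossing D, lift_point x P & sgn x = s;
  plane_nxt := fun p q =>
    exists2 r : passage D, lift_point r.1 p.1 /\ r.2 = p.2
      & q = (p.1 + dsp r, (nxt D r).2) |}.

Definition doubly_periodic_weave (W : plane_diagram) : Prop :=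
  exists2 D : diagram, weaving_motif D & lift D = W.

Definition periodic_lattice (W : plane_diagram) (L : set plane) : Prop :=
  exists D : diagram, [/\ weaving_motif D, lattice D = L & lift D = W].

Definition minimal_lattice (W : plane_diagram) (L : set plane) : Prop :=
  periodic_lattice W L /\ forall L', periodic_lattice W L' -> tiled_by L L'.

Definition motif_of (W : plane_diagram) (D : diagram) : Prop :=
  weaving_motif D /\
  exists D0 : diagram, [/\ weaving_motif D0, lift D0 = W & same_weave D0 D].

Definition minimal_motif (W : plane_diagram) (D : diagram) : Prop :=
  motif_of W D /\ minimal_lattice W (lattice D).

End Plane.

(* Main.v *)
(** Count only the crossings whose two strands, in the lift to the plane, belong
    to different threads, and call the others self-crossings of a thread.  The signed
    count of the former crossings is unchanged by every elementary move: the crossing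
    of a kink is a self-crossing of one thread, the two crossings of a bigon have
    opposite signs and involve the same two threads, and a triangle move preserves
    each crossing together with its two threads.  Since the threads of a weaving
    motif are unknotted, this count is the whole writhe of a motif.  Two motifs on
    the minimal lattice are thus compared through motifs on that lattice with the
    same lift, whose crossings match one by one. *)

Require Import Defs.

Set Implicit Arguments.
Unset Strict Implicit.
Unset Printing Implicit Defensive.

Import Order.TTheory GRing.Theory Num.Theory.
Local Open Scope ring_scope.

(** * Threads of the lifted diagram *)

Section Threads.
Variable R : realType.
Implicit Types D E : diagram R.

(** Asking for a common later passage lets transitivity follow by adding step counts. As [lift_nxt]
    is injective, it means that one of the two lies further along the thread, see [same_threadP]. *)
Definition same_thread D (a b : passage D * plane R) : Prop :=
  exists n m, iter n (@lift_nxt R D) a = iter m (@lift_nxt R D) b.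

Lemma same_thread_refl D (a : passage D * plane R) : same_thread a a.
Proof. by exists 0%N, 0%N. Qed.

Lemma same_thread_sym D (a b : passage D * plane R) :
  same_thread a b -> same_thread b a.
Proof. by case=> n [m e]; exists m, n. Qed.

Lemma same_thread_trans D (b a c : passage D * plane R) :
  same_thread a b -> same_thread b c -> same_thread a c.
Proof.
case=> n [m e] [k [l e']]; exists (k + n)%N, (m + l)%N.
by rewrite iterD e -iterD addnC iterD e' -iterD.
Qed.

Lemma lift_nxt_inj D : injective (@lift_nxt R D).
Proof.
by case=> p P [q Q] [] /perm_inj -> /= /addIr ->.
Qed.

Lemma iter_lift_nxt_inj D n : injective (iter n (@lift_nxt R D)).
Proof. by elim: n => [|n IHn] a b //= /lift_nxt_inj /IHn. Qed.

Lemma same_threadP D (a b : passage D * plane R) :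
  same_thread a b <->
  (exists n, iter n (@lift_nxt R D) a = b) \/
  (exists n, iter n (@lift_nxt R D) b = a).
Proof.
split=> [[n [m e]] | [[n e] | [n e]]]; last 2 first.
- by exists n, 0%N.
- by exists 0%N, n.
have [le_nm | /ltnW le_mn] := leqP n m.
- right; exists (m - n)%N; apply: (@iter_lift_nxt_inj D n).
  by rewrite -iterD subnKC.
- left; exists (n - m)%N; apply: (@iter_lift_nxt_inj D m).
  by rewrite -iterD subnKC.
Qed.

Lemma same_thread_nxt D (p : passage D) P :
  same_thread (p, P) (nxt D p, P + dsp p).
Proof. by exists 1%N, 0%N. Qed.

Section Map.
Variables (D E : diagram R).
Variable phi : passage D * plane R -> passage E * plane R.
Hypothesis phi_nxt : forall a, lift_nxt (phi a) = phi (lift_nxt a).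

Lemma iter_lift_nxt_map n a :
  iter n (@lift_nxt R E) (phi a) = phi (iter n (@lift_nxt R D) a).
Proof. by elim: n => //= n ->. Qed.

(** Isotopies, Dehn twists and triangle moves all act on lifted passages by maps [phi] commuting
    with [lift_nxt], and so carry threads to threads. *)
Lemma same_thread_map a b : same_thread a b -> same_thread (phi a) (phi b).
Proof. by case=> n [m e]; exists n, m; rewrite !iter_lift_nxt_map e. Qed.

Lemma same_thread_map_inj a b : injective phi ->
  same_thread (phi a) (phi b) <-> same_thread a b.
Proof.
move=> phiI; split=> [[n [m]]|]; last exact: same_thread_map.
by rewrite !iter_lift_nxt_map => /phiI e; exists n, m.
Qed.

End Map.

(** * Self-crossings of threads and the writhe without them *)

Lemma same_thread_shift D t (p q : passage D) P Q :
  same_thread (p, P) (q, Q) -> same_thread (p, P + t) (q, Q + t).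
Proof.
apply: (@same_thread_map D D (fun a => (a.1, a.2 + t))) => -[r S].
by rewrite /lift_nxt /= addrAC.
Qed.

(* By translation, the base point 0 stands for any lift of x. *)
Definition thread_crossing D (x : crossing D) : Prop :=
  same_thread (x, true, 0) (x, false, 0).

Lemma thread_crossingP D (x : crossing D) b P :
  thread_crossing x <-> same_thread (x, b, P) (x, ~~ b, P).
Proof.
have h0 : thread_crossing x <-> same_thread (x, true, P) (x, false, P).
  by split=> [/(same_thread_shift P)|/(same_thread_shift (- P))];
     rewrite ?add0r ?subrr.
case: b => //; split=> [/h0 /same_thread_sym // | /same_thread_sym /h0 //].
Qed.

Definition thread_writhe D : int :=
  \sum_(x : crossing D | ~~ `[< thread_crossing x >]) (if sgn x then 1 else -1).

Lemma weaving_motif_thread_writhe D : weaving_motif D -> thread_writhe D = writhe D.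
Proof.
case=> _ _ unknot _; apply: eq_bigl => x; apply/negP => /asboolP.
move/(thread_crossingP x true (pos x)) => /same_threadP.
have lift_pos : lift_point x (pos x).
  by exists 0, 0; rewrite subrr !mulr0z addr0.
(* Whichever of the two passages comes first along the thread, [unknot] started there with no
   preliminary step excludes the return. *)
case=> -[n e].
- exact: (unknot (x, true) (pos x) 0%N n x true).
- exact: (unknot (x, false) (pos x) 0%N n x false).
Qed.

(** The crossings outside [S] are the image of [f], which preserves signs and self-crossings; only
    the part of the sum over [S] is left over. Bijections are the case of empty [S]. *)
Lemma thread_writhe_embed D E (S : {set crossing E}) (f : crossing D -> crossing E) :
    injective f -> (forall y, y \notin S <-> exists x, f x = y) ->
    (forall x, sgn (f x) = sgn x) ->
    (forall x, thread_crossing (f x) <-> thread_crossing x) ->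
  thread_writhe E = thread_writhe D +
    \sum_(y in S | ~~ `[< thread_crossing y >]) (if sgn y then 1 else -1).
Proof.
move=> f_inj f_im f_sgn f_thread.
rewrite /thread_writhe (bigID (mem S)) /= addrC; congr (_ + _); last first.
  by apply: eq_bigl => y; rewrite andbC.
rewrite (eq_bigl (mem (f @: [set x | ~~ `[< thread_crossing x >]]))); last first.
  move=> y; apply/andP/imsetP => [[yt /f_im [x xy]] | [x]].
    exists x => //; rewrite inE; apply: contra yt => /asboolP /f_thread.
    by rewrite xy => ?; apply/asboolP.
  rewrite inE => xt ->; split; last by apply/f_im; exists x.
  by apply: contra xt => /asboolP /f_thread ?; apply/asboolP.
rewrite big_imset /=; last by move=> x y _ _ /f_inj.
by apply: eq_big => [x|x _]; rewrite ?inE ?f_sgn.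
Qed.

Lemma thread_writhe_bij D E (f : crossing D -> crossing E) :
    bijective f -> (forall x, sgn (f x) = sgn x) ->
    (forall x, thread_crossing (f x) <-> thread_crossing x) ->
  thread_writhe D = thread_writhe E.
Proof.
move=> [g fK gK] f_sgn f_thread.
rewrite (@thread_writhe_embed D E finset.set0 f) //; first by rewrite big1 ?addr0 // => y; rewrite inE.
  exact: can_inj fK.
by move=> y; rewrite inE; split=> // _; exists (g y).
Qed.

(** * Isotopies and Dehn twists *)

Lemma on_passages_inj (A B : Type) (f : A -> B) :
  injective f -> injective (on_passages f).
Proof. by move=> f_inj [x b] [y c] [] /f_inj -> ->. Qed.

Lemma isotopic_thread_writhe D E : isotopic D E -> thread_writhe D = thread_writhe E.
Proof.
case=> _ [f [t [f_bij f_sgn f_nxt f_dsp _]]].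
apply: (thread_writhe_bij f_bij f_sgn) => x.
pose phi (a : passage D * plane R) := (on_passages f a.1, a.2 + t a.1.1).
(* The base point on the side of [E] is chosen as the image under [phi] of the base point 0. *)
rewrite (thread_crossingP x true 0) (thread_crossingP (f x) true (0 + t x)).
apply: (@same_thread_map_inj D E phi _ (x, true, 0) (x, false, 0)).
- case=> p P; rewrite /lift_nxt /phi /= f_nxt f_dsp.
  by congr pair; rewrite -!addrA; congr (_ + _); rewrite addrC -!addrA addNr addr0.
- case=> p P [q Q] /= e; have /(on_passages_inj (bij_inj f_bij)) /= epq := congr1 fst e.
  by subst q; congr pair; apply: (addIr (t p.1)); exact: (congr1 snd e).
Qed.

(** In the basis [u], [v] the map is triangular with unit diagonal, so [M] has determinant 1. *)
Lemma shear_inj (u v : plane R) (M : 'M[R]_2) :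
  det2 u v != 0 -> u *m M = u -> v *m M = u + v -> injective (fun P : plane R => P *m M).
Proof.
move=> uv0 uM vM P Q /= ePQ.
suff MU : M \in unitmx by rewrite -[P](mulmxK MU) ePQ mulmxK.
have uvM : (col_mx u v : 'M_2) *m M =
    (block_mx (1%:M : 'M_1) 0 1%:M (1%:M : 'M_1) : 'M_2) *m (col_mx u v : 'M_2).
  by rewrite (@mul_col_mx _ 1 1 2 2) uM vM (@mul_block_col _ 1 1 1 1 2) !mul1mx mul0mx addr0.
move/(congr1 determinant): uvM; rewrite !det_mulmx (@det_lblock _ 1 1) !det1 !mul1r.
by rewrite -[in RHS](mulr1 (\det _)) => /(mulfI uv0) M1; rewrite unitmxE M1 unitr1.
Qed.

Lemma dehn_twist_thread_writhe D E :
  dehn_twist D E -> thread_writhe D = thread_writhe E.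
Proof.
case=> _ [u [v [M [f [[[uv0 _] uM vM] [f_bij f_sgn f_nxt f_dsp _]]]]]].
have M_inj := shear_inj uv0 uM vM.
apply: (thread_writhe_bij f_bij f_sgn) => x.
pose phi (a : passage D * plane R) := (on_passages f a.1, (a.2 : plane R) *m M).
rewrite (thread_crossingP x true 0) (thread_crossingP (f x) true (0 *m M)).
apply: (@same_thread_map_inj D E phi _ (x, true, 0) (x, false, 0)).
- by case=> p P; rewrite /lift_nxt /phi /= f_nxt f_dsp mulmxDl.
- case=> p P [q Q] /= e; have /(on_passages_inj (bij_inj f_bij)) /= epq := congr1 fst e.
  by subst q; congr pair; apply: M_inj; exact: (congr1 snd e).
Qed.

(** * Forgetting crossings *)

Lemma iter_lift_nxtE D n (p : passage D) P :
  iter n (@lift_nxt R D) (p, P) =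
  (iter n (nxt D) p, P + \sum_(k < n) dsp (iter k (nxt D) p)).
Proof.
elim: n => [|n IHn]; first by rewrite big_ord0 addr0.
by rewrite /= IHn big_ord_recr /lift_nxt /= addrA.
Qed.

(** One step in [D] is the first return in [E] to a crossing outside [S]. Threads of [D] are thus
    threads of [E] with some passages skipped, and a surviving crossing is a self-crossing in one
    diagram exactly when it is in the other. *)
Lemma forgets_thread_writhe D E (S : {set crossing E}) : forgets D S ->
  thread_writhe E = thread_writhe D +
    \sum_(y in S | ~~ `[< thread_crossing y >]) (if sgn y then 1 else -1).
Proof.
case=> _ _ [f [f_inj f_im f_sgn _ f_walk]].
apply: (thread_writhe_embed f_inj f_im) => // x.
pose phi (a : passage D * plane R) := (on_passages f a.1, a.2).
have phi_nxt a : exists n,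
    (forall k, (0 < k <= n)%N -> (iter k (@lift_nxt R E) (phi a)).1.1 \in S) /\
    iter n.+1 (@lift_nxt R E) (phi a) = phi (lift_nxt a).
  case: a => p P; have [n [inS eD eP]] := f_walk p; exists n; split=> [k /inS|].
    by rewrite iter_lift_nxtE.
  rewrite (_ : phi (p, P) = (on_passages f p, P)) // iter_lift_nxtE -eP.
  by congr pair; exact: eD.
have phi_notin a : (phi a).1.1 \notin S by apply/f_im; exists a.1.1.
have phi_inj : injective phi.
  case=> p P [q Q] e; have /(on_passages_inj f_inj) /= -> := congr1 fst e.
  by have /= -> := congr1 snd e.
(* Strong induction on the number of steps in [E], cutting the walk at the first return. *)
have thread_down n a b : iter n (@lift_nxt R E) (phi a) = phi b -> same_thread a b.
  have [m] := ubnP n; elim: m n a => // m IHm [|n] a.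
    by move=> _ /phi_inj ->; exact: same_thread_refl.
  rewrite ltnS => lt_nm e; have [k [inS ek]] := phi_nxt a.
  (* A walk stopping before the first return would end at a crossing of [S], unlike [phi b].
     Otherwise [k.+1] steps are used up and [n - k] remain. *)
  have [le_nk | lt_kn] := leqP n.+1 k.
    by have := inS n.+1 le_nk; rewrite e (negPf (phi_notin b)).
  apply: (@same_thread_trans D (lift_nxt a)).
    by case: (a) => p P; exact: same_thread_nxt.
  apply: (IHm (n - k)%N); first exact: leq_ltn_trans (leq_subr _ _) lt_nm.
  by rewrite -ek -iterD -e; congr iter; rewrite addnS subnK.
have thread_up n a : same_thread (phi a) (phi (iter n (@lift_nxt R D) a)).
  elim: n => [|n IHn]; first exact: same_thread_refl.
  apply: same_thread_trans IHn _; rewrite iterS.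
  by have [k [_ <-]] := phi_nxt (iter n (@lift_nxt R D) a); exists k.+1, 0%N.
rewrite /thread_crossing; split=> /same_threadP[] [n].
- exact: (thread_down n (x, true, 0) (x, false, 0)).
- by move/(thread_down n (x, false, 0) (x, true, 0)); exact: same_thread_sym.
- by move=> e; have := thread_up n (x, true, 0); rewrite e.
- by move=> e; apply: same_thread_sym; have := thread_up n (x, false, 0); rewrite e.
Qed.

(** * Region boundaries; removal of kinks and bigons *)

Lemma same_thread_dart D (d : dart D) P :
  same_thread (d.1, P) ((other_end d).1, P + dart_dsp d).
Proof.
case: d => p [] /=; first exact: same_thread_nxt.
rewrite /other_end /dart_dsp /=.
apply: same_thread_sym; have := same_thread_nxt ((nxt D)^-1%g p) (P - dsp ((nxt D)^-1%g p)).
by rewrite permKV subrK.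
Qed.

Lemma face_closed D (d : dart D) (s : seq (dart D))  :
  torus_diagram D -> fcycle (@face R D) s -> uniq s -> d \in s ->
  \sum_(i < size s) dart_dsp (iter i (@face R D) d) = 0.
Proof. by move=> [_ [_ _ closed _]] cs us ds; rewrite -(order_cycle cs us ds). Qed.

Lemma face_passage D (d : dart D) :
  (face d).1 = ((other_end d).1.1, ~~ (other_end d).1.2).
Proof. by rewrite /face /rot_inv; case: (other_end d) => -[x []] o. Qed.

(** This parity rule compares the signs of the crossings met around a region. *)
Lemma face_orient D (d : dart D) :
  (face d).2 = d.2 (+) (other_end d).1.2 (+) sgn (other_end d).1.1.
Proof.
rewrite /face /rot_inv; have -> : d.2 = ~~ (other_end d).2.
  by rewrite /other_end; case: d.2.
by case: (other_end d) => -[x b] o /=; case: b; case: o; case: (sgn x).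
Qed.

Lemma reidemeister1_thread_writhe D E : torus_diagram E ->
  reidemeister1 D E -> thread_writhe D = thread_writhe E.
Proof.
move=> torE [d [dd /forgets_thread_writhe->]].
rewrite big1 ?addr0 // => y /andP[]; rewrite inE => /eqP-> /asboolP[].
(* The side of the kink lifts to a closed loop, so it joins the two passages of the crossing at the
   same lifted point. *)
have d0 : \sum_(i < 1) dart_dsp (iter i (@face R E) d) = 0.
  by apply: (@face_closed E d [:: d]); rewrite //= ?inE ?dd ?eqxx.
rewrite big_ord1 /= in d0.
apply/(thread_crossingP d.1.1 d.1.2 0).
have := same_thread_dart d 0; rewrite d0 addr0 -surjective_pairing.
have := face_passage d; rewrite dd => e.
suff -> : (other_end d).1 = (d.1.1, ~~ d.1.2) by [].
by rewrite e /= negbK -surjective_pairing.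
Qed.

Lemma reidemeister2_thread_writhe D E : torus_diagram E ->
  reidemeister2 D E -> thread_writhe D = thread_writhe E.
Proof.
move=> torE [d [ddd xy over /forgets_thread_writhe->]].
have fd_neq : d != face d by apply: contra_not_neq xy => <-.
have d0 : \sum_(i < 2) dart_dsp (iter i (@face R E) d) = 0.
  by apply: (@face_closed E d [:: d; face d]); rewrite //= ?inE ?ddd ?eqxx ?fd_neq.
rewrite big_ord_recl big_ord1 /= in d0.
have fp := face_passage d.
have fp' : d.1 = _ := etrans (congr1 fst (esym ddd)) (face_passage (face d)).
have e1 : (other_end d).1 = ((face d).1.1, d.1.2).
  by rewrite fp /= -over -surjective_pairing.
have e2 : (other_end (face d)).1 = (d.1.1, ~~ d.1.2).
  by rewrite fp' /= negbK -surjective_pairing.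
(* The orientation bit returns to its value after the two sides. The two levels met are opposite and
   contribute one flip, so the signs must contribute another. *)
have sxy : sgn (face d).1.1 = ~~ sgn d.1.1.
  have := face_orient (face d); rewrite ddd face_orient e1 e2 /=.
  by case: d.2; case: d.1.2; case: (sgn d.1.1); case: (sgn (face d).1.1).
(* Each side joins passages of the same level at the two corners, and since the boundary closes up
   both sides lead to the same lift of the second corner. *)
have txy : thread_crossing d.1.1 <-> thread_crossing (face d).1.1.
  have h1 := same_thread_dart d 0.
  have h2 := same_thread_dart (face d) (0 + dart_dsp d).
  rewrite e1 in h1; rewrite -addrA d0 addr0 e2 fp e1 /= in h2.
  rewrite (thread_crossingP d.1.1 d.1.2 0).
  rewrite (thread_crossingP (face d).1.1 d.1.2 (0 + dart_dsp d)).
  rewrite -surjective_pairing; split=> h.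
    by apply: same_thread_trans (same_thread_sym h1) (same_thread_trans h (same_thread_sym h2)).
  by apply: same_thread_trans h1 (same_thread_trans h h2).
rewrite big_mkcondr big_setU1 ?inE ?(introN eqP xy) //= big_set1.
rewrite (asbool_equiv_eq txy) sxy.
by case: ifP => _; case: (sgn d.1.1); rewrite ?addrN ?addNr ?addr0.
Qed.

(** * Triangle moves *)

Lemma slide_arc D (d : dart D)
    (a1 := arc_start d) (a2 := arc_start (face d)) (a3 := arc_start (face (face d))) :
    uniq [:: a1; nxt D a1; a2; nxt D a2; a3; nxt D a3] ->
  forall a, a \in [:: a1; a2; a3] ->
  [/\ slide d a = nxt D a, slide d (nxt D a) = a,
      slide_dsp d a = dsp a & slide_dsp d (nxt D a) = - dsp a].
Proof.
rewrite /slide /slide_dsp -/a1 -/a2 -/a3.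
(* Each inequality is kept in both directions, so that every test in the three transpositions can be
   rewritten. *)
have neqs (x y : passage D) : x != y -> ((x == y) = false) * ((y == x) = false).
  by rewrite [y == x]eq_sym => /negPf ->.
rewrite /= !inE !negb_or -!andbA !andbT.
move=> /and5P[/neqs n1 /neqs n2 /neqs n3 /neqs n4
    /and5P[/neqs n5 /neqs n6 /neqs n7 /neqs n8 /and5P[/neqs n9 /neqs n10 /neqs n11 /neqs n12
    /and3P[/neqs n13 /neqs n14 /neqs n15]]]].
pose neq := (n1, n2, n3, n4, n5, n6, n7, n8, n9, n10, n11, n12, n13, n14, n15).
move=> a; rewrite !inE => /or3P[] /eqP ->; split;
  rewrite ?(big_cons, big_nil, permM, permE) /=; do 3!rewrite ?(eqxx, neq) /=;
  by rewrite ?(addr0, subr0, add0r, sub0r).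
Qed.

(** The three transpositions have disjoint supports, so [slide d] is an involution. It moves a
    passage only to the other end of a side, hence along its own thread. *)
Lemma slideP D (d : dart D)
    (a1 := arc_start d) (a2 := arc_start (face d)) (a3 := arc_start (face (face d))) :
    uniq [:: a1; nxt D a1; a2; nxt D a2; a3; nxt D a3] ->
  forall p P, [/\ same_thread (p, P) (slide d p, P + slide_dsp d p),
    slide d (slide d p) = p & slide_dsp d (slide d p) = - slide_dsp d p].
Proof.
move=> uniq_ends p P; have arc := slide_arc uniq_ends.
have end_arc a : a \in [:: a1; a2; a3] -> p = a \/ p = nxt D a ->
    [/\ same_thread (p, P) (slide d p, P + slide_dsp d p),
      slide d (slide d p) = p & slide_dsp d (slide d p) = - slide_dsp d p].
  move=> /arc[sa sb da db] [] ->.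
    by rewrite !(sa, sb, da, db); split=> //; exact: same_thread_nxt.
  rewrite !(sa, sb, da, db) opprK; split=> //.
  by apply: same_thread_sym; have := same_thread_nxt a (P - dsp a); rewrite subrK.
have [ | ] := boolP (p \in flatten [seq [:: a; nxt D a] | a <- [:: a1; a2; a3]]).
  case/flatten_mapP=> a a_arc; rewrite !inE => p_a; apply: (end_arc a a_arc).
  by case/orP: p_a => /eqP; auto.
rewrite /= !inE !negb_or => /and5P[pa1 pb1 pa2 pb2 /andP[pa3 pb3]].
have sp : slide d p = p by rewrite /slide !permM !tpermD // eq_sym.
have dp : slide_dsp d p = 0.
  rewrite /slide_dsp !big_cons big_nil -/a1 -/a2 -/a3.
  by rewrite !(negPf pa1, negPf pa2, negPf pa3, negPf pb1, negPf pb2, negPf pb3) subrr !addr0.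
by rewrite !sp dp addr0 oppr0; split=> //; exact: same_thread_refl.
Qed.

Lemma dart_ends D (d : dart D) :
  perm_eq [:: arc_start d; nxt D (arc_start d)] [:: d.1; (other_end d).1].
Proof.
rewrite /arc_start /other_end; case: d => p []; first exact: perm_refl.
by rewrite /= permKV; apply/permPl; exact: (perm_catC [:: _] [:: _]).
Qed.

(** By [face_passage], consecutive sides meet a corner in its two different passages. The six ends
    are therefore all the passages of three distinct crossings. *)
Lemma triangle_ends_uniq D (d : dart D) : face (face (face d)) = d ->
    uniq [:: d.1.1; (face d).1.1; (face (face d)).1.1] ->
  uniq (flatten [seq [:: arc_start e; nxt D (arc_start e)]
                | e <- [:: d; face d; face (face d)]]).
Proof.
move=> tri; have := congr1 fst tri; rewrite [LHS]face_passage => e3.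
have e1 := face_passage d; have e2 := face_passage (face d).
rewrite (perm_uniq (perm_cat (dart_ends d) (perm_cat (dart_ends (face d))
  (perm_cat (dart_ends (face (face d))) (perm_refl [::]))))) /=.
rewrite -e3 e1 e2 /=; case: (other_end d).1 (other_end (face d)).1
  (other_end (face (face d))).1 => [y b] [z c] [x e].
rewrite /= !inE !xpair_eqE !negb_or -!andbA !andbT => /and3P[/negPf xy /negPf xz /negPf yz].
by rewrite ?(eq_sym y x) ?(eq_sym z y) ?(eq_sym z x) !(xy, xz, yz, eqxx) /=;
  case: (b); case: (c); case: (e).
Qed.

Lemma reidemeister3_thread_writhe D E :
  reidemeister3 D E -> thread_writhe D = thread_writhe E.
Proof.
case=> _ [d [f [[tri corners _ _] [f_bij f_sgn _ f_nxt f_dsp]]]].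
have slide_p := slideP (triangle_ends_uniq tri corners).
apply: (thread_writhe_bij f_bij f_sgn) => x.
pose phi (a : passage D * plane R) :=
  (on_passages f (slide d a.1), a.2 + slide_dsp d a.1).
(* Since [slide d] is an involution, the lift of [p] in [E] is the image under [phi] of its slid
   position, which lies on the thread of [p] in [D]. *)
have phi_slide p : phi (slide d p, 0 + slide_dsp d p) = (on_passages f p, 0).
  by have [_ sp dp] := slide_p p 0; rewrite /phi /= sp dp add0r subrr.
rewrite /thread_crossing -(phi_slide (x, true)) -(phi_slide (x, false)).
have [slide_t _ _] := slide_p (x, true) 0; have [slide_f _ _] := slide_p (x, false) 0.
have phi_nxt a : lift_nxt (phi a) = phi (lift_nxt a).
  case: a => p P; rewrite /lift_nxt /phi /= f_nxt f_dsp.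
  by congr pair; rewrite -!addrA; congr (_ + _); rewrite addrCA; congr (_ + _); rewrite addrA subrr add0r.
have phi_inj : injective phi.
  case=> p P [q Q] e; have /(on_passages_inj (bij_inj f_bij)) /= /perm_inj epq := congr1 fst e.
  by subst q; congr pair; apply: (addIr (slide_dsp d p)); exact: (congr1 snd e).
rewrite same_thread_map_inj //; split=> h.
  exact: same_thread_trans slide_t (same_thread_trans h (same_thread_sym slide_f)).
exact: same_thread_trans (same_thread_sym slide_t) (same_thread_trans h slide_f).
Qed.

(** * Invariance along sequences of moves *)

Lemma elementary_move_thread_writhe D E :
  elementary_move D E -> thread_writhe D = thread_writhe E.
Proof.
case=> _ torE [[|]|||].
- exact: isotopic_thread_writhe.
- exact: dehn_twist_thread_writhe.
- exact: reidemeister1_thread_writhe.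
- exact: reidemeister2_thread_writhe.
- exact: reidemeister3_thread_writhe.
Qed.

Lemma elementary_move_lattice D E : elementary_move D E -> lattice D = lattice E.
Proof.
by case=> _ _ [[[]|[]]|[d [_ []]]|[d [_ _ _ []]]|[]].
Qed.

Lemma same_weave_thread_writhe D E : same_weave D E -> thread_writhe D = thread_writhe E.
Proof.
elim=> {D E} [D E | D | D E _ | D E F _ DE _ EF] //.
- exact: elementary_move_thread_writhe.
- by rewrite DE.
Qed.

Lemma same_weave_lattice D E : same_weave D E -> lattice D = lattice E.
Proof.
elim=> {D E} [D E | D | D E _ | D E F _ DE _ EF] //.
- exact: elementary_move_lattice.
- by rewrite DE.
Qed.

(** Intermediate diagrams may have self-crossings of threads, and their writhe may vary;
    [thread_writhe] is constant and equals the writhe at both ends, which are motifs. *)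
Lemma motif_writhe D E : weaving_motif D -> weaving_motif E -> same_weave D E ->
  writhe D = writhe E.
Proof.
by move=> mD mE /same_weave_thread_writhe; rewrite !weaving_motif_thread_writhe.
Qed.

(** * The minimal lattice and motifs with a common lift *)

Lemma lattice_spanD (u v a b : plane R) :
  lattice_span u v a -> lattice_span u v b -> lattice_span u v (a + b).
Proof.
by move=> [x [y ->]] [x' [y' ->]]; exists (x + x'), (y + y'); rewrite !mulrzDr addrACA.
Qed.

Lemma tiled_by_sub (L L' : set (plane R)) : tiled_by L L' -> (L' `<=` L)%classic.
Proof.
case=> u [v [u' [v' [ku [kv [[_ ->] [_ ->] _ _ [-> ->]]]]]]] w [x [y ->]].
by exists (ku%:Z * x), (kv%:Z * y); rewrite !mulrzA.
Qed.

(** Each lattice tiles the other, and tiling gives the reverse inclusion of translations. *)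
Lemma minimal_lattice_uniq (W : plane_diagram R) (L L' : set (plane R)) :
  minimal_lattice W L -> minimal_lattice W L' -> L = L'.
Proof.
move=> [WL minL] [WL' minL']; apply/seteqP; split; apply: tiled_by_sub.
- exact: minL'.
- exact: minL.
Qed.

Lemma lift_crossing D E (x : crossing D) : lift D = lift E ->
  exists y : crossing E, lift_point y (pos x) /\ sgn y = sgn x.
Proof.
move=> DE; suff: plane_crossing (lift E) (pos x) (sgn x) by case=> y; exists y.
rewrite -DE; exists x => //; exists 0, 0.
by rewrite subrr !mulr0z addr0.
Qed.

(** Crossings of either diagram correspond to lattice orbits of signed points in the common lift.
    The choices [f] and [g] are mutually inverse because distinct crossings lie in distinct
    orbits. *)
Lemma lift_writhe D E : torus_diagram D -> torus_diagram E ->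
  lattice D = lattice E -> lift D = lift E -> writhe D = writhe E.
Proof.
move=> [[_ posD _] _] [[_ posE _] _] LDE DE.
have [f f_spec] := boolp.choice (fun x : crossing D => lift_crossing x DE).
have [g g_spec] := boolp.choice (fun y : crossing E => lift_crossing y (esym DE)).
rewrite /writhe (reindex f) /=; first by apply: eq_bigr => x _; rewrite (f_spec x).2.
exists g => [x _ | y _].
  apply/esym/posD; rewrite -[pos x](subrK (pos (f x))) -addrA.
  by apply: lattice_spanD (g_spec (f x)).1; rewrite -/(lattice D _) LDE; exact: (f_spec x).1.
apply/esym/posE; rewrite -[pos y](subrK (pos (g y))) -addrA.
by apply: lattice_spanD (f_spec (g y)).1; rewrite -/(lattice E _) -LDE; exact: (g_spec y).1.
Qed.

End Threads.

Theorem theorem1p2 (R : realType) (W : plane_diagram R) (D1 D2 : diagram R)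
    (hW : doubly_periodic_weave W)
    (hmin1 : minimal_motif W D1) (hmin2 : minimal_motif W D2)
    (hconn1 : connected_diagram D1) (hconn2 : connected_diagram D2)
    (hred1 : reduced D1) (hred2 : reduced D2)
    (halt1 : alternating D1) (halt2 : alternating D2) :
  writhe D1 = writhe D2.
Proof.
case: hmin1 => [[m1 [E1 [n1 l1 w1]]] min1]; case: hmin2 => [[m2 [E2 [n2 l2 w2]]] min2].
rewrite -(motif_writhe n1 m1 w1) -(motif_writhe n2 m2 w2).
case: (n1) (n2) => tor1 _ _ _ [tor2 _ _ _].
apply: (lift_writhe tor1 tor2); last by rewrite l1 l2.
(* Moves fix the lattice, so [E1] and [E2] inherit the minimal lattices of [D1] and [D2], which
   coincide. *)
rewrite (same_weave_lattice w1) (same_weave_lattice w2).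
exact: minimal_lattice_uniq min1 min2.
Qed.
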